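(* Let $(W,S)$ be a Coxeter system, let $I,J\subset S$ be finitary, and let $p$ be a core $(I,J)$-coset. Then $p$ has a reduced atomic expression, i.e. a reduced expression which is a composition (concatenation) of reduced expressions $[[I_{i-1}\subset M_i\supset I_i]]$ of atomic cosets.
   Context: Let $(W,S)$ be a Coxeter system with length function $\ell$. A subset $I\subset S$ is finitary if the parabolic subgroup $W_I$ is finite; then $w_I$ is the longest element of $W_I$ and $\ell(I):=\ell(w_I)$. For finitary $I,J$, an $(I,J)$-coset is an element $p\in W_I\backslash W/W_J$ (the pair $(I,J)$ is part of the data); it has a unique maximal element $\overline{p}$ and a unique minimal element $\underline{p}$ in the Bruhat order. The coset $p$ is a core coset if $I=\underline{p}\,J\,\underline{p}^{-1}$ (as sets of simple reflections). A (multistep) $(I,J)$-expression is a sequence of finitary subsets $[[I=I_0\subset K_1\supset I_1\subset K_2\supset\cdots\subset K_m\supset I_m=J]]$ (equalities permitted). It is a reduced expression for $p$ if $\overline{p}=w_{K_1}w_{I_1}^{-1}w_{K_2}w_{I_2}^{-1}\cdots w_{I_{m-1}}^{-1}w_{K_m}$ and $\ell(\overline{p})=\ell(K_1)-\ell(I_1)+\ell(K_2)-\cdots-\ell(I_{m-1})+\ell(K_m)$. Atomic coset: let $M\subset S$ be finitary, $s\in M$, $t=w_Msw_M$, $I=M\setminus\{s\}$, $J=M\setminus\{t\}$; the $(I,J)$-coset containing $w_M$ is called atomic, and its reduced expression is $[[I\subset M\supset J]]$. A reduced atomic expression for $p$ is a reduced expression $[[I=I_0\subset M_1\supset I_1\subset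 M_2\supset\cdots\subset M_k\supset I_k=J]]$ for $p$ such that each piece $[[I_{i-1}\subset M_i\supset I_i]]$ is the reduced expression of an atomic coset; the trivial expression $[I]$ (with $k=0$) is allowed, and is the reduced expression of the identity $(I,I)$-coset $W_I$. *)

(* Defs.v *)
From Stdlib Require Import Relations.
From HB Require Import structures.
From mathcomp Require Import all_boot all_order all_algebra.
From mathcomp Require Import boolp classical_sets functions cardinality.

Set Implicit Arguments.
Unset Strict Implicit.
Unset Printing Implicit Defensive.

Local Open Scope classical_set_scope.
Local Open Scope group_scope.

(* The generating set S may be infinite.  Words are sequences of elements of
   the group itself. *)
Definition word_on (W : groupType) (S : set W) (u : seq W) : Prop :=
  forall s, s \in u -> S s.

Definition word_prod (W : groupType) (u : seq W) : W := \prod_(s <- u) s.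

(* The value 0 encodes m s t = oo; only the values of m on S are relevant. *)
Definition coxeter_matrix (W : groupType) (S : set W) (m : W -> W -> nat) :
    Prop :=
  forall s t, S s -> S t -> m s t = m t s /\ (m s t = 1%N <-> s = t).

(* The congruence on words generated by (s t)^(m s t) = 1.  As m s s = 1 on S,
   the letters are involutions, so this monoid congruence is the one defining
   the group < S | (s t)^(m s t) = 1 when m s t is finite >. *)
Inductive coxeter_equiv (W : groupType) (S : set W) (m : W -> W -> nat) :
    seq W -> seq W -> Prop :=
| coxeter_rel u v s t : S s -> S t -> (0 < m s t)%N ->
    coxeter_equiv S m (u ++ flatten (nseq (m s t) [:: s; t]) ++ v) (u ++ v)
| coxeter_refl u : coxeter_equiv S m u u
| coxeter_sym u v : coxeter_equiv S m u v -> coxeter_equiv S m v u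
| coxeter_trans u v w :
    coxeter_equiv S m u v -> coxeter_equiv S m v w -> coxeter_equiv S m u w.

Definition coxeter_system (W : groupType) (S : set W) : Prop :=
  exists m : W -> W -> nat,
    [/\ coxeter_matrix S m,
        forall w, exists2 u, word_on S u & word_prod u = w
      & forall u v, word_on S u -> word_on S v ->
          (word_prod u = word_prod v <-> coxeter_equiv S m u v)].

Definition has_word_of_length (W : groupType) (S : set W) (w : W) (n : nat) :
    Prop :=
  exists u, [/\ word_on S u, word_prod u = w & size u = n].

Definition len (W : groupType) (S : set W) (w : W) : nat :=
  xget 0%N [set n | has_word_of_length S w n /\
                    forall k, has_word_of_length S w k -> (n <= k)%N].

Definition reflection (W : groupType) (S : set W) : set W :=
  [set t | exists w s, S s /\ t = w * s * w^-1].

Definition bruhat_step (W : groupType) (S : set W) (u v : W) : Prop :=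
  (exists2 t, reflection S t & v = u * t) /\ (len S u < len S v)%N.

Definition bruhat (W : groupType) (S : set W) : W -> W -> Prop :=
  clos_refl_trans W (bruhat_step S).

Definition is_subgroup (W : groupType) (H : set W) : Prop :=
  H 1 /\ forall x y, H x -> H y -> H (x * y^-1).

Definition parabolic (W : groupType) (I : set W) : set W :=
  smallest (@is_subgroup W) I.

Definition finitary (W : groupType) (S I : set W) : Prop :=
  I `<=` S /\ finite_set (parabolic I).

Definition longest (W : groupType) (S I : set W) : W :=
  xget 1 [set w | parabolic I w /\
                  forall v, parabolic I v -> (len S v <= len S w)%N].

(* For finitary I and J, an (I,J)-coset is a set p with is_coset I J p; the
   pair (I,J) is always passed along with p. *)
Definition dcoset (W : groupType) (I J : set W) (w : W) : set W :=
  [set x | exists a b, [/\ parabolic I a, parabolic J b & x = a * w * b]].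

Definition is_coset (W : groupType) (I J p : set W) : Prop :=
  exists w, p = dcoset I J w.

Definition coset_max (W : groupType) (S p : set W) : W :=
  xget 1 [set x | p x /\ forall y, p y -> bruhat S x y -> y = x].

Definition coset_min (W : groupType) (S p : set W) : W :=
  xget 1 [set x | p x /\ forall y, p y -> bruhat S y x -> y = x].

Definition core_coset (W : groupType) (S I J p : set W) : Prop :=
  is_coset I J p /\
  I = [set coset_min S p * s * (coset_min S p)^-1 | s in J].

(* [[I = I_0 < K_1 > I_1 < ... < K_m > I_m = J]] is represented by I together
   with the list [:: (K_1, I_1); ...; (K_m, I_m)]. *)
Fixpoint expression (W : groupType) (S I J : set W)
    (e : seq (set W * set W)) : Prop :=
  finitary S I /\
  match e with
  | [::] => I = J
  | (K, I1) :: e' =>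
      [/\ finitary S K, I `<=` K, I1 `<=` K & expression S I1 J e']
  end.

Fixpoint expr_prod (W : groupType) (S : set W)
    (e : seq (set W * set W)) : W :=
  match e with
  | [::] => 1
  | [:: (K, _)] => longest S K
  | (K, I1) :: e' => longest S K * (longest S I1)^-1 * expr_prod S e'
  end.

Fixpoint expr_len (W : groupType) (S : set W)
    (e : seq (set W * set W)) : int :=
  match e with
  | [::] => 0
  | [:: (K, _)] => (len S (longest S K))%:Z
  | (K, I1) :: e' =>
      (len S (longest S K))%:Z - (len S (longest S I1))%:Z + expr_len S e'
  end%R.

(* The alternating formula has no meaning for the trivial expression [I],
   which is the reduced expression of the identity coset. *)
Definition reduced_expression (W : groupType) (S I J p : set W)
    (e : seq (set W * set W)) : Prop :=
  expression S I J e /\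
  match e with
  | [::] => p = parabolic I
  | _ => coset_max S p = expr_prod S e /\
         (len S (coset_max S p))%:Z%R = expr_len S e
  end.

Definition atomic_coset (W : groupType) (S I J p : set W) : Prop :=
  exists M s, [/\ finitary S M, M s, I = M `\ s,
    J = M `\ (longest S M * s * longest S M) & p = dcoset I J (longest S M)].

Fixpoint atomic_pieces (W : groupType) (S I : set W)
    (e : seq (set W * set W)) : Prop :=
  match e with
  | [::] => True
  | (M, I1) :: e' =>
      (exists2 q, atomic_coset S I I1 q &
                  reduced_expression S I I1 q [:: (M, I1)]) /\
      atomic_pieces S I1 e'
  end.

Definition reduced_atomic_expression (W : groupType) (S I J p : set W)
    (e : seq (set W * set W)) : Prop :=
  reduced_expression S I J p e /\ atomic_pieces S I e.

(* Main.v *)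
From Stdlib Require Import Relations.
Require Import Defs.
From mathcomp Require Import all_boot all_order all_algebra.
From mathcomp Require Import boolp classical_sets functions cardinality.
From mathcomp Require Import zify.

(* Let x be the minimal element of p, so that p = W_I x = x W_J and the
   longest element of p is y = w_I x = x w_J.  If x <> 1, pick s in S with
   sx < x, and let M = I + s.  Every element of I is a left descent of w_I x,
   and s is a left descent of x w_J, so all of M are left descents of y.  Hence
   W_M is finite and y = w_M x' with lengths adding up.  Then x' is shorter
   than x and is the minimal element of a core (I', J)-coset, where
   I' = w_M I w_M = M - w_M s w_M, and [[I < M > I']] is atomic.  Induction on
   the length of x concludes.

   The exchange condition comes from the presentation: the parity of the number
   of occurrences of a reflection among the reflections attached to a word is
   unchanged by the defining relations. *)

Set Implicit Arguments.
Unset Strict Implicit.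
Unset Printing Implicit Defensive.

Local Open Scope classical_set_scope.
Local Open Scope group_scope.

(** * Words, their products and their reflections *)

Section Words.
Context (W : groupType).
Implicit Types (s t r w : W) (u v : seq W).

Lemma word_prod_nil : word_prod [::] = 1 :> W.
Proof. by rewrite /word_prod big_nil. Qed.

Lemma word_prod_cons s u : word_prod (s :: u) = s * word_prod u.
Proof. by rewrite /word_prod big_cons. Qed.

Lemma word_prod_cat u v : word_prod (u ++ v) = word_prod u * word_prod v.
Proof. by rewrite /word_prod big_cat. Qed.

Lemma word_on_cons (S : set W) s u : word_on S (s :: u) <-> S s /\ word_on S u.
Proof.
split=> [uS|[sS uS] r]; last by rewrite inE => /orP[/eqP->//|/uS].
split=> [|r ru]; apply: uS; first exact: mem_head.
by rewrite inE ru orbT.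
Qed.

Lemma word_on_cat (S : set W) u v :
  word_on S (u ++ v) <-> word_on S u /\ word_on S v.
Proof.
split=> [uvS|[uS vS] r]; last by rewrite mem_cat => /orP[/uS|/vS].
by split=> r rP; apply: uvS; rewrite mem_cat rP ?orbT.
Qed.

Lemma word_on_sub (S T : set W) u : S `<=` T -> word_on S u -> word_on T u.
Proof. by move=> ST uS r /uS /ST. Qed.

(* For u = s_1 ... s_k, the reflections
   (s_1 ... s_(i-1)) s_i (s_1 ... s_(i-1))^-1. *)
Fixpoint refl_seq u : seq W :=
  if u is s :: u' then s :: [seq r ^ s^-1 | r <- refl_seq u'] else [::].

Lemma refl_seq_cat u v :
  refl_seq (u ++ v) =
  refl_seq u ++ [seq r ^ (word_prod u)^-1 | r <- refl_seq v].
Proof.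
elim: u => [|s u IHu] /=.
  by rewrite word_prod_nil invg1 (eq_map (@conjg1 W)) map_id.
rewrite IHu map_cat -map_comp word_prod_cons; congr (_ :: _ ++ _).
by apply: eq_map => r /=; rewrite -conjgM -invgM.
Qed.

(** Each prefix of the alternating word conjugates the next letter to an alternating palindrome of
    odd length, that is [(s * t) ^+ i * s]. In this form the periodicity in [i] is visible. *)
Lemma refl_seq_alternating s t m : s * s = 1 -> t * t = 1 ->
  refl_seq (flatten (nseq m [:: s; t])) =
  [seq (s * t) ^+ i * s | i <- iota 0 (m + m)].
Proof.
move=> ss tt; have sV : s^-1 = s by apply: mulg1_eq.
have tV : t^-1 = t by apply: mulg1_eq.
elim: m => [//|m IHm].
rewrite addSn addnS /= IHm expg0 mul1g expg1; congr [:: _, _ & _].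
  by rewrite /conjg invgK sV mulgA.
rewrite -map_comp (iotaDl 2 0) -!map_comp; apply: eq_map => i /=.
rewrite /conjg !invgK sV tV add2n 2!expgS !mulgA; congr (_ * _).
by rewrite -!(mulgA _ s t) -[LHS]mulgA -[RHS]mulgA -expgS -expgSr.
Qed.

(** Multiplying by the reflection attached to a letter replays the prefix before it, cancels that
    letter and leaves the rest. *)
Lemma refl_seq_split u r : (forall s, s \in u -> s * s = 1) ->
  r \in refl_seq u -> exists u1 s u2,
    u = u1 ++ s :: u2 /\ r * word_prod u = word_prod (u1 ++ u2).
Proof.
elim: u r => [//|s u IHu] r uinv /=; rewrite inE => /predU1P[->|].
  exists [::], s, u; split=> //.
  by rewrite word_prod_cons mulgA uinv ?mem_head // mul1g.
case/mapP=> r' r'u ->.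
have [|u1 [a [u2 [-> E]]]] := IHu _ _ r'u.
  by move=> a au; apply: uinv; rewrite inE au orbT.
exists (s :: u1), a, u2; split=> //.
by rewrite /= !word_prod_cons -E /conjg invgK !mulgA mulgVK.
Qed.

End Words.

(** * Consequences of the presentation *)

Section CoxeterGroup.
Context (W : groupType) (S : set W) (hS : coxeter_system S).
Implicit Types (s t r w x y z a b c : W) (u v : seq W) (I J M : set W).
Local Notation ell := (len S).

Lemma gen_involution s : S s -> s * s = 1.
Proof.
case: hS => m [mP _ eqP] sS.
have mss : m s s = 1%N by case: (mP s s sS sS) => _ [_ ->].
rewrite -[RHS](@word_prod_nil W) -[s * s]mulg1 -mulgA.
rewrite -(@word_prod_nil W) -!word_prod_cons.
apply/eqP => //; first by do !(apply/word_on_cons; split).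
by have := coxeter_rel (m := m) [::] [::] sS sS; rewrite mss /=; apply.
Qed.

Lemma gen_inv s : S s -> s^-1 = s.
Proof. by move=> sS; apply/mulg1_eq/gen_involution. Qed.

(** An inserted relator has product 1, so the reflections coming from the letters after it do not
    change; those of the relator itself come in equal pairs. *)
Lemma odd_count_refl_seq u v t : word_on S u -> word_on S v ->
  word_prod u = word_prod v ->
  odd (count_mem t (refl_seq u)) = odd (count_mem t (refl_seq v)).
Proof.
case: hS => m [mP _ eqP] uS vS /(eqP _ _ uS vS) uv.
suff [_ ->//] : word_prod u = word_prod v /\ forall t,
  odd (count_mem t (refl_seq u)) = odd (count_mem t (refl_seq v)).
elim: uv {uS vS t} => {u v} [u v s t sS tS mst|//||].
- have stS : word_on S (flatten (nseq (m s t) [:: s; t])).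
    elim: (m s t) => [//|k IHk] /=.
    by do !(apply/word_on_cons; split).
  have st1 : word_prod (flatten (nseq (m s t) [:: s; t])) = 1.
    rewrite -(@word_prod_nil W); apply/eqP => //.
    by have := coxeter_rel (m := m) [::] [::] sS tS mst; rewrite cats0.
  split=> [|r]; first by rewrite !word_prod_cat st1 mul1g.
  rewrite !refl_seq_cat !count_cat !oddD st1 invg1 (eq_map (@conjg1 W)) map_id.
  congr (_ (+) _); rewrite -[RHS]addFb map_cat count_cat oddD; congr (_ (+) _).
  have stm : (s * t) ^+ m s t = 1.
    rewrite -st1; elim: (m s t) => [|k IHk]; first by rewrite word_prod_nil.
    by rewrite /= !word_prod_cons -IHk expgS mulgA.
  rewrite refl_seq_alternating ?gen_involution // iotaD !map_cat.
  rewrite count_cat oddD.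
  (* The indices [i] and [m s t + i] give the same reflection because [(s * t) ^+ m s t = 1], so the
     two halves cancel modulo 2. *)
  have -> : iota (0 + m s t) (m s t) =
      [seq (m s t + i)%N | i <- iota 0 (m s t)].
    by rewrite add0n -iotaDl addn0.
  have -> : [seq (s * t) ^+ i * s |
               i <- [seq (m s t + i)%N | i <- iota 0 (m s t)]]
      = [seq (s * t) ^+ i * s | i <- iota 0 (m s t)].
    rewrite -map_comp; apply: eq_map => i /=.
    by rewrite expgnDr stm mul1g.
  exact: addbb.
- by move=> u v _ [-> h]; split.
- by move=> u v w _ [-> h1] _ [-> h2]; split=> // r; rewrite h1.
Qed.


(** * Length and the exchange condition *)

Lemma len_word u : word_on S u -> (ell (word_prod u) <= size u)%N.
Proof.
move=> uS; rewrite /len; case: xgetP => [n _ [_ nmin]|//].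
by apply: nmin; exists u.
Qed.

Lemma reduced_word w :
  exists u, [/\ word_on S u, word_prod u = w & size u = ell w].
Proof.
suff : has_word_of_length S w (ell w) by [].
rewrite /len; case: xgetP => [n _ []//|none].
case: hS => m [_ /(_ w)[u uS uw] _].
have ex : exists n, `[< has_word_of_length S w n >].
  by exists (size u); apply/asboolP; exists u.
case: (ex_minnP ex) => n /asboolP nw nmin; case: (none n); split=> // k kw.
by apply: nmin; apply/asboolP.
Qed.

Lemma len1 : ell 1 = 0%N.
Proof. by apply/eqP; rewrite -leqn0 -word_prod_nil len_word. Qed.

Lemma len_eq0 w : ell w = 0%N -> w = 1.
Proof.
case: (reduced_word w) => u [_ <- <-] /size0nil ->; exact: word_prod_nil.
Qed.

Lemma lenM x y : (ell (x * y) <= ell x + ell y)%N.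
Proof.
have [u [uS ux <-]] := reduced_word x; have [v [vS vy <-]] := reduced_word y.
by rewrite -ux -vy -word_prod_cat -size_cat len_word //; apply/word_on_cat.
Qed.

Lemma word_prod_rev u : word_on S u -> word_prod (rev u) = (word_prod u)^-1.
Proof.
elim: u => [_|s u IHu /word_on_cons[sS uS]].
  by rewrite word_prod_nil invg1.
rewrite rev_cons -cats1 word_prod_cat IHu // !word_prod_cons word_prod_nil.
by rewrite mulg1 invgM (gen_inv sS).
Qed.

Lemma lenV x : ell x^-1 = ell x.
Proof.
have leV y : (ell y^-1 <= ell y)%N.
  have [u [uS <- <-]] := reduced_word y.
  rewrite -word_prod_rev // -size_rev len_word // => r.
  by rewrite mem_rev; apply: uS.
by apply/eqP; rewrite eqn_leq leV -{1}[x]invgK leV.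
Qed.

Lemma len_refl_seq u r : word_on S u -> r \in refl_seq u ->
  (ell (r * word_prod u) < size u)%N.
Proof.
move=> uS /refl_seq_split[|u1 [s [u2 [E ->]]]].
  by move=> s /uS; apply: gen_involution.
move: uS; rewrite {u}E => /word_on_cat[u1S /word_on_cons[_ u2S]].
by rewrite size_cat addnS ltnS -size_cat len_word //; apply/word_on_cat.
Qed.

(** If [s] is not in [refl_seq u], it occurs exactly once in [refl_seq (s :: u)], since conjugation
    by [s] fixes [s]. By parity it occurs for a reduced word [v] of [s * word_prod u], and deleting
    the corresponding letter of [v] shows that [word_prod u] is the shorter of the two. *)
Lemma exchange u s : word_on S u -> S s ->
  (ell (s * word_prod u) <= ell (word_prod u))%N -> s \in refl_seq u.
Proof.
move=> uS sS; apply: contraTT => su; rewrite -ltnNge.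
have [v [vS vE vsz]] := reduced_word (s * word_prod u).
rewrite -[X in (ell X < _)%N](mulKg s) gen_inv // -vsz -vE len_refl_seq //.
rewrite -has_pred1 has_count.
suff /odd_gt0 : odd (count_mem s (refl_seq v)) by [].
rewrite -(@odd_count_refl_seq (s :: u) v) ?word_prod_cons //; last first.
  exact/word_on_cons.
rewrite /= eqxx count_map (@eq_count _ _ (pred1 s)) => [|r /=].
  by rewrite (count_memPn su).
have {2}<- : s ^ s^-1 = s by rewrite /conjg invgK mulgV mulg1.
by rewrite (inj_eq (@conjg_inj _ _)).
Qed.

(** The weak inequality in [exchange] covers equality: equal lengths would then force [s * w] to be
    strictly shorter. *)
Lemma len_genM_neq s w : S s -> ell (s * w) != ell w.
Proof.
move=> sS; apply/eqP => E; have [u [uS uw usz]] := reduced_word w.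
have /(len_refl_seq uS) : s \in refl_seq u by apply: exchange; rewrite ?uw ?E.
by rewrite uw E usz ltnn.
Qed.

Lemma len_gen s : S s -> ell s = 1%N.
Proof.
move=> sS; apply/eqP.
rewrite eqn_leq lt0n -{2}[s]mulg1 -{2}len1 len_genM_neq //.
have := @len_word [:: s]; rewrite word_prod_cons word_prod_nil mulg1 andbT.
by apply; apply/word_on_cons.
Qed.

Lemma len_genMP s w : S s ->
  ell (s * w) = (ell w).+1 \/ ell w = (ell (s * w)).+1.
Proof.
move=> sS; have := len_genM_neq w sS.
have := lenM s w; have := lenM s (s * w).
rewrite mulgA gen_involution // mul1g (len_gen sS); lia.
Qed.

(** * Parabolic subgroups *)

Lemma parabolic_word I a : I `<=` S ->
  parabolic I a <-> exists2 u, word_on I u & word_prod u = a.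
Proof.
move=> IS; split=> [aI|[u uI <-] H [[H1 HV] IH]].
  apply: (aI [set a | exists2 u, word_on I u & word_prod u = a]); split.
    split=> /=; first by exists [::]; rewrite ?word_prod_nil.
    move=> _ _ [u uI <-] [v vI <-]; exists (u ++ rev v).
      by apply/word_on_cat; split=> // r; rewrite mem_rev; apply: vI.
    by rewrite word_prod_cat word_prod_rev //; apply: word_on_sub vI.
  move=> s sI; exists [:: s]; first exact/word_on_cons.
  by rewrite word_prod_cons word_prod_nil mulg1.
elim: u uI => [_|s u IHu /word_on_cons[sI uI]]; first by rewrite word_prod_nil.
rewrite word_prod_cons -[word_prod u]invgK; apply: (HV); first exact: IH.
by rewrite -[_^-1]mul1g; apply: (HV) => //; apply: IHu.
Qed.

Lemma parabolic1 I : parabolic I 1.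
Proof. by move=> H [[]]. Qed.

Lemma parabolicV I a : parabolic I a -> parabolic I a^-1.
Proof.
move=> aI H [[H1 HV] IH]; rewrite -[_^-1]mul1g; apply: (HV) => //; exact: aI.
Qed.

Lemma parabolicM I a b : parabolic I a -> parabolic I b -> parabolic I (a * b).
Proof.
move=> aI /parabolicV bI H [[H1 HV] IH]; rewrite -[b]invgK.
by apply: (HV); [exact: aI|exact: bI].
Qed.

Lemma sub_parabolic I s : I s -> parabolic I s.
Proof. by move=> sI H [_]; apply. Qed.

Lemma parabolicS I J : I `<=` J -> parabolic I `<=` parabolic J.
Proof. by move=> IJ a aI H [HG JH]; apply: aI; split=> // s /IJ/JH. Qed.

(** Exchange only deletes letters, so reducing a word in [I] never leaves [I]. Hence [len S] is also
    the length of W_I with respect to [I]. *)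
Lemma reduced_parabolic_word I a : I `<=` S -> parabolic I a ->
  exists u, [/\ word_on I u, word_prod u = a & size u = ell a].
Proof.
move=> IS /(parabolic_word _ IS)[u uI <-].
elim: u uI => [_|s u IHu /word_on_cons[sI /IHu[v [vI vu vsz]]]].
  by exists [::]; rewrite word_prod_nil len1.
have vS := word_on_sub IS vI; rewrite word_prod_cons -vu.
rewrite -vu in vsz; have [E|E] := len_genMP (word_prod v) (IS _ sI).
  exists (s :: v); rewrite word_prod_cons E -vsz; split=> //.
  exact/word_on_cons.
have sv : s \in refl_seq v.
  by apply: exchange; [|exact: IS|rewrite E].
have [|v1 [r [v2 [vE sE]]]] := refl_seq_split _ sv.
  by move=> r /vS; apply: gen_involution.
move: vI; rewrite vE => /word_on_cat[v1I /word_on_cons[_ v2I]].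
exists (v1 ++ v2); rewrite -vE -sE; split=> //; first exact/word_on_cat.
by apply: eq_add_S; rewrite -E -vsz vE !size_cat /= addnS.
Qed.

Lemma len1_parabolic I a : I `<=` S -> parabolic I a -> ell a = 1%N -> I a.
Proof.
move=> IS /(reduced_parabolic_word IS)[[|s [|r u]] [uI <- <-]] // _.
by rewrite word_prod_cons word_prod_nil mulg1; apply: uI; apply: mem_head.
Qed.

Lemma parabolic_gen I s : I `<=` S -> S s -> parabolic I s -> I s.
Proof. by move=> IS sS sI; apply: len1_parabolic => //; exact: len_gen. Qed.

(** Induction along a reduced word in [I], read from its right end. *)
Lemma parabolic_ind I (P : W -> Prop) : I `<=` S -> P 1 ->
  (forall s a, I s -> parabolic I a -> ell (s * a) = (ell a).+1 -> P a ->
    P (s * a)) ->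
  forall a, parabolic I a -> P a.
Proof.
move=> IS P1 PM a /(reduced_parabolic_word IS)[u [uI <-]].
elim: u uI => [_ _|s u IHu /word_on_cons[sI uI]].
  by rewrite word_prod_nil.
rewrite word_prod_cons /= => E.
have uS := word_on_sub IS uI; have sS := IS _ sI.
have usz : size u = ell (word_prod u).
  by have := len_word uS; have := len_genMP (word_prod u) sS; lia.
apply: PM => //; [|by rewrite -E -usz|exact: IHu].
by apply/parabolic_word => //; exists u.
Qed.

Lemma parabolic_descent I a : I `<=` S -> parabolic I a -> a <> 1 ->
  exists s, I s /\ (ell (s * a) < ell a)%N.
Proof.
move=> IS aI; elim/parabolic_ind: a / aI => // s a sI _ E _ _; exists s.
by rewrite mulgA gen_involution ?mul1g ?E //; apply: IS.
Qed.

(* The exchange condition, applied to a reduced word of [b] followed by one of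
   [b^-1 z], deletes a letter of the second factor. *)
Lemma len_descents I z b : I `<=` S ->
  (forall s, I s -> (ell (s * z) < ell z)%N) -> parabolic I b ->
  (ell (b^-1 * z) + ell b)%N = ell z.
Proof.
move=> IS zI bI; elim/parabolic_ind: b / bI => //.
  by rewrite invg1 mul1g len1 addn0.
move=> s b sI bI sb IHb; have sS := IS _ sI.
have [v [vI vb vsz]] := reduced_parabolic_word IS bI.
have [u [uS ub usz]] := reduced_word (b^-1 * z).
have vS := word_on_sub IS vI.
have uvz : word_prod (v ++ u) = z by rewrite word_prod_cat vb ub mulVKg.
have : s \in refl_seq (v ++ u).
  apply: exchange => //; first exact/word_on_cat.
  by rewrite uvz ltnW // zI.
rewrite refl_seq_cat mem_cat => /orP[/(len_refl_seq vS)|].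
  by rewrite vb sb vsz ltnNge leqnSn.
rewrite vb => /mapP[r ru sr].
have := len_refl_seq uS ru; rewrite ub usz.
have -> : r * (b^-1 * z) = (s * b)^-1 * z.
  by rewrite invgM (gen_inv sS) sr /conjg invgK !mulgA mulVg mul1g.
have := lenM (s * b) ((s * b)^-1 * z); rewrite mulVKg sb; lia.
Qed.

(** Lengths add over an element [y] of least length in W_I y: a failure would, by exchange, delete a
    letter of [y] and produce a shorter element of that coset. It remains to see that [x], only
    assumed to have no left descent in [I], is such an element. *)
Lemma len_parabolicM I x a : I `<=` S ->
  (forall s, I s -> (ell x < ell (s * x))%N) -> parabolic I a ->
  ell (a * x) = (ell a + ell x)%N.
Proof.
move=> IS xI.
have addI y : (forall c, parabolic I c -> (ell y <= ell (c * y))%N) ->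
    forall c, parabolic I c -> ell (c * y) = (ell c + ell y)%N.
  move=> ymin c cI; elim/parabolic_ind: c / cI => //.
    by rewrite mul1g len1.
  move=> s c sI cI sc IHc; have sS := IS _ sI; rewrite sc addSn -IHc -mulgA.
  have [//|E] := len_genMP (c * y) sS.
  have [v [vI vc vsz]] := reduced_parabolic_word IS cI.
  have [u [uS uy usz]] := reduced_word y.
  have vS := word_on_sub IS vI.
  have : s \in refl_seq (v ++ u).
    apply: exchange => //; first exact/word_on_cat.
    by rewrite word_prod_cat vc uy E.
  rewrite refl_seq_cat mem_cat => /orP[/(len_refl_seq vS)|].
    by rewrite vc sc vsz ltnNge leqnSn.
  rewrite vc => /mapP[r ru sr].
  have := len_refl_seq uS ru; rewrite uy usz ltnNge ymin //.
  have -> : r = c^-1 * s * c.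
    by rewrite sr /conjg invgK !mulgA mulVg mul1g mulgVK.
  do !apply: parabolicM => //; [exact: parabolicV|exact: sub_parabolic].
have ex : exists n, `[< exists2 c, parabolic I c & ell (c * x) = n >].
  exists (ell x); apply/asboolP; exists 1; rewrite ?mul1g //.
  exact: parabolic1.
case: (ex_minnP ex) => n /asboolP[c cI cn] nmin.
have ymin d : parabolic I d -> (ell (c * x) <= ell (d * (c * x)))%N.
  move=> dI; rewrite cn nmin //; apply/asboolP.
  by exists (d * c); [exact: parabolicM|rewrite mulgA].
(* Otherwise a left descent [s] of [c^-1] also shortens [x = c^-1 * (c * x)], by additivity over
   [c * x], against [xI]. *)
suff c1 : c = 1 by move: ymin; rewrite c1 mul1g => /addI; apply.
apply: contrapT => cN1.
have {}cN1 : c^-1 <> 1 by move=> cV; apply: cN1; rewrite -[c]invgK cV invg1.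
have [s [sI sc]] := parabolic_descent IS (parabolicV cI) cN1.
have := xI _ sI; have := addI _ ymin _ (parabolicV cI); rewrite mulKg.
have := addI _ ymin (s * c^-1); rewrite -mulgA mulKg => -> //; first lia.
by apply: parabolicM; [exact: sub_parabolic|exact: parabolicV].
Qed.

(** * Finiteness and longest elements *)

Lemma finite_word_prods I n : finite_set I ->
  finite_set [set w | exists u, [/\ word_on I u, word_prod u = w & size u = n]].
Proof.
move=> Ifin; elim: n => [|n IHn].
  apply: (@sub_finite_set _ _ [set 1]); last exact: finite_set1.
  by move=> _ [[|s u] [_ <- //] _]; rewrite word_prod_nil.
apply: sub_finite_set (finite_image2 (fun s w => s * w) Ifin IHn).
move=> _ [[|s u] [+ <- //]]; move=> /word_on_cons[sI uI] [usz].
by exists s => //; exists (word_prod u); [exists u|rewrite word_prod_cons].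
Qed.

(** By [len_descents] no element of W_I is longer than [z], and a finite alphabet has finitely many
    words of bounded length. *)
Lemma finitary_descents I z : I `<=` S -> finite_set I ->
  (forall s, I s -> (ell (s * z) < ell z)%N) -> finitary S I.
Proof.
move=> IS Ifin zI; split=> //.
apply: (@sub_finite_set _ _ (\bigcup_(n in `I_(ell z).+1)
  [set w | exists u, [/\ word_on I u, word_prod u = w & size u = n]])).
  move=> w wI; have [u uP] := reduced_parabolic_word IS wI.
  exists (ell w) => /=; last by exists u.
  by have := len_descents IS zI wI; lia.
by apply: bigcup_finite => // n _; apply: finite_word_prods.
Qed.

Lemma longestP I : finitary S I -> parabolic I (longest S I) /\
  forall c, parabolic I c -> (ell c <= ell (longest S I))%N.
Proof.
move=> [IS Ifin]; rewrite /longest; case: xgetP => [//|none].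
have /finite_seqP[r rE] := Ifin.
have ex : exists n, `[< exists2 c, parabolic I c & ell c = n >].
  by exists (ell 1); apply/asboolP; exists 1 => //; apply: parabolic1.
have bd n : `[< exists2 c, parabolic I c & ell c = n >] ->
    (n <= \max_(c <- r) ell c)%N.
  move=> /asboolP[c cI <-]; apply: leq_bigmax_seq => //.
  by move: cI; rewrite rE.
case: (ex_maxnP ex bd) => n /asboolP[c cI <-] cmax.
case: (none c); split=> // v vI; apply: cmax; apply/asboolP.
by exists v.
Qed.

Lemma longest_descent I s : finitary S I -> I s ->
  (ell (s * longest S I) < ell (longest S I))%N.
Proof.
move=> If sI; have [wI wmax] := longestP If.
rewrite ltn_neqAle len_genM_neq ?wmax //; last by case: If => + _; apply.
by apply: parabolicM => //; apply: sub_parabolic.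
Qed.

Lemma len_longest I b : finitary S I -> parabolic I b ->
  (ell (b^-1 * longest S I) + ell b)%N = ell (longest S I).
Proof.
move=> If; apply: len_descents; first by case: If.
by move=> s; apply: longest_descent.
Qed.

(** [len_longest] at [b = (longest S I)^-1] leaves length 0 for the square of the longest
    element. *)
Lemma longestV I : finitary S I -> (longest S I)^-1 = longest S I.
Proof.
move=> If; apply/mulg1_eq/len_eq0.
have := len_longest If (parabolicV (longestP If).1); rewrite invgK lenV.
by rewrite -[RHS]add0n => /addIn.
Qed.

(** [len_longest] at [b = s * longest S I], which is one shorter than [longest S I], shows that the
    conjugate has length 1; an element of W_I of length 1 lies in [I]. *)
Lemma longest_conj I s : finitary S I -> I s ->
  I (longest S I * s * longest S I).
Proof.
move=> If sI; have [IS _] := If; have [wI wmax] := longestP If.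
have swI : parabolic I (s * longest S I).
  by apply: parabolicM => //; apply: sub_parabolic.
apply: len1_parabolic => //.
  by rewrite -mulgA; apply: parabolicM.
have E : (ell (longest S I * s * longest S I) + ell (s * longest S I))%N =
    ell (longest S I).
  have := len_longest If swI.
  by rewrite invgM longestV // (gen_inv (IS _ sI)).
have := longest_descent If sI.
have := len_genMP (longest S I) (IS _ sI); lia.
Qed.

Lemma longest_conjK I a : finitary S I ->
  longest S I * (longest S I * a * longest S I) * longest S I = a.
Proof.
move=> If; have w2 : longest S I * longest S I = 1.
  by rewrite -{1}(longestV If) mulVg.
by rewrite -!mulgA w2 mulg1 mulgA w2 mul1g.
Qed.

(** * Bruhat order and extremal elements of cosets *)

Lemma bruhat_len x y : bruhat S x y -> x = y \/ (ell x < ell y)%N.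
Proof.
elim=> [a b [_ ab]|a|a b c _ [->|ab] _ [<-|bc]]; [right|left|..] => //.
- by left.
- by right.
- by right.
by right; apply: ltn_trans bc.
Qed.

Lemma bruhat_gen s x : S s -> (ell x < ell (s * x))%N -> bruhat S x (s * x).
Proof.
(* Left multiplication by [s] is right multiplication by the reflection [x^-1 * s * x]. *)
move=> sS lt; apply: rt_step; split=> //; exists (x^-1 * s * x).
  by exists x^-1, s; rewrite invgK.
by rewrite !mulgA mulgV mul1g.
Qed.

(** Going from [y] to [c * y] loses exactly [ell c]. So for [c] other than 1, cancelling a left
    descent of [c] gives a larger element of the coset, and only [y] is maximal. *)
Lemma coset_max_descents I y : I `<=` S ->
  (forall s, I s -> (ell (s * y) < ell y)%N) ->
  coset_max S [set x | exists2 c, parabolic I c & x = c * y] = y.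
Proof.
move=> IS ydesc; set p := [set x | _].
have plen c : parabolic I c -> (ell (c * y) + ell c)%N = ell y.
  move=> /parabolicV cI.
  by have := len_descents IS ydesc cI; rewrite invgK lenV.
apply: xget_unique.
  split=> [|_ [c cI ->] /bruhat_len[//|]].
    by exists 1; rewrite ?mul1g //; apply: parabolic1.
  by have := plen _ cI; lia.
move=> _ [[c cI ->] cmax].
have [->|cN1] := pselect (c = 1); first by rewrite mul1g.
have [s [sI sc]] := parabolic_descent IS cI cN1.
have scI : parabolic I (s * c) by apply: parabolicM => //; apply: sub_parabolic.
have pscy : p (s * (c * y)) by exists (s * c); rewrite ?mulgA.
have lt : (ell (c * y) < ell (s * (c * y)))%N.
  rewrite -(ltn_add2r (ell c)) (plen _ cI) mulgA -(plen _ scI).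
  by rewrite ltn_add2l.
by have E := cmax _ pscy (bruhat_gen (IS _ sI) lt); rewrite E ltnn in lt.
Qed.

Lemma coset_minP p : p !=set0 -> p (coset_min S p) /\
  forall s, S s -> p (s * coset_min S p) ->
    (ell (coset_min S p) < ell (s * coset_min S p))%N.
Proof.
move=> [z pz]; rewrite /coset_min; case: xgetP => [x _ [px xmin]|none].
  split=> // s sS psx; have [->//|E] := len_genMP x sS.
  have ss : s * (s * x) = x by rewrite mulgA gen_involution ?mul1g.
  have /(xmin _ psx) sx : bruhat S (s * x) x.
    by rewrite -{2}ss; apply: bruhat_gen => //; rewrite ss E.
  by move: E; rewrite sx; lia.
(* An element of least length is Bruhat minimal, so the default value of [coset_min] cannot
   occur. *)
have ex : exists n, `[< exists2 x, p x & ell x = n >].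
  by exists (ell z); apply/asboolP; exists z.
case: (ex_minnP ex) => n /asboolP[x px xn] nmin; case: (none x); split=> //.
move=> y py /bruhat_len[//|]; rewrite xn ltnNge nmin //.
by apply/asboolP; exists y.
Qed.

(** * Core cosets *)

Lemma parabolic_conj I J x b : I = [set x * s * x^-1 | s in J] ->
  parabolic J b -> parabolic I (x * b * x^-1).
Proof.
move=> IE bJ.
apply: (bJ [set b | parabolic I (x * b * x^-1)]); split=> [|s sJ] /=.
  split=> [|c d /= cI dI] /=; first by rewrite mulg1 mulgV; apply: parabolic1.
  have -> : x * (c * d^-1) * x^-1 = (x * c * x^-1) * (x * d * x^-1)^-1.
    by rewrite !invgM invgK !mulgA mulgVK.
  by apply: parabolicM => //; apply: parabolicV.
by apply: sub_parabolic; rewrite IE; exists s.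
Qed.

(** Conjugation by [x] carries the right factor from W_J into W_I, so one side suffices. *)
Lemma dcoset_core I J x : I = [set x * s * x^-1 | s in J] ->
  dcoset I J x = [set y | exists2 c, parabolic I c & y = c * x].
Proof.
move=> IE; apply/seteqP; split=> [_ [a [b [aI bJ ->]]]|_ [c cI ->]].
  exists (a * (x * b * x^-1)); last by rewrite !mulgA mulgVK.
  by apply: parabolicM => //; apply: parabolic_conj bJ.
by exists c, 1; rewrite mulg1; split=> //; apply: parabolic1.
Qed.

(** Write w_I x = x (x^-1 w_I x). Conjugation by [x^-1] sends [I] into [J], hence does not increase
    length on W_I, so a descent of [x] remains one after the factor is appended. *)
Lemma core_longest_descent I J x s : finitary S I -> J `<=` S ->
  I = [set x * r * x^-1 | r in J] ->
  (forall r, I r -> (ell x < ell (r * x))%N) ->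
  S s -> (ell (s * x) < ell x)%N ->
  (ell (s * (longest S I * x)) < ell (longest S I * x))%N.
Proof.
move=> If JS IE xI sS sx; have [IS _] := If; have [wI _] := longestP If.
have conjx a : parabolic I a -> (ell (x^-1 * a * x) <= ell a)%N.
  move=> aI; elim/parabolic_ind: a / aI => //.
    by rewrite mulg1 mulVg len1.
  move=> r a rI _ ->; move: rI; rewrite IE => -[r' r'J <-] IHa.
  have -> : x^-1 * (x * r' * x^-1 * a) * x = r' * (x^-1 * a * x).
    by rewrite !mulgA mulVg mul1g.
  have := lenM r' (x^-1 * a * x); rewrite (len_gen (JS _ r'J)); lia.
rewrite (len_parabolicM IS xI wI).
have -> : s * (longest S I * x) = s * x * (x^-1 * longest S I * x).
  by rewrite !mulgA mulgK.
by have := conjx _ wI; have := lenM (s * x) (x^-1 * longest S I * x); lia.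
Qed.

(** The conjugation factors in three: [x] takes [J] to [I], w_I permutes [I], and w_M takes [I],
    which is [M] without [s], to [M] without w_M s w_M. *)
Lemma core_shift I J x s M : ~ I s -> M = s |` I ->
  finitary S I -> finitary S M -> I = [set x * r * x^-1 | r in J] ->
  M `\ (longest S M * s * longest S M) =
    [set (longest S M * (longest S I * x)) * r *
         (longest S M * (longest S I * x))^-1 | r in J].
Proof.
move=> sNI ME If Mf IE.
have IV := longestV If; have MV := longestV Mf.
have MK a := longest_conjK a Mf; have IK a := longest_conjK a If.
have conjE r : longest S M * (longest S I * x) * r *
      (longest S M * (longest S I * x))^-1 =
    longest S M * (longest S I * (x * r * x^-1) * longest S I) * longest S M.
  by rewrite !invgM IV MV !mulgA.
apply/seteqP; split=> [r [rM rt]|_ [r rJ <-]].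
  have : I (longest S M * r * longest S M).
    have := longest_conj Mf rM; rewrite {1}ME => -[E|//].
    by case: rt; rewrite -E MK.
  move=> /(longest_conj If); rewrite {1}IE => -[j jJ E].
  by exists j => //; rewrite conjE E IK MK.
have rI : I (x * r * x^-1) by rewrite IE; exists r.
rewrite conjE; split.
  by apply: longest_conj => //; rewrite ME; right; apply: longest_conj.
move=> /= E; apply: sNI; rewrite -[s]MK -E MK.
exact: longest_conj.
Qed.

(** * Building the atomic expression *)

Lemma expression_finitary I J e : expression S I J e -> finitary S I.
Proof. by case: e => [|[K I1] e] []. Qed.

(** Since w_M exchanges the two subsets, the coset is one-sided, and [coset_max_descents] identifies
    its maximum as w_M. *)
Lemma atomic_piece M s (I' := M `\ (longest S M * s * longest S M)) :
  finitary S M -> M s ->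
  exists2 q, atomic_coset S (M `\ s) I' q &
    reduced_expression S (M `\ s) I' q [:: (M, I')].
Proof.
move=> Mf sM; have [MS Mfin] := Mf.
have fD r : finitary S (M `\ r).
  split; first by move=> a [/MS].
  by apply: sub_finite_set Mfin; apply: parabolicS => a [].
have MK a := longest_conjK a Mf.
exists (dcoset (M `\ s) I' (longest S M)); first by exists M, s.
have IE : M `\ s = [set longest S M * r * (longest S M)^-1 | r in I'].
  rewrite longestV //; apply/seteqP; split=> [a [aM ase]|_ [r [rM rt] <-]].
    exists (longest S M * a * longest S M); last exact: MK.
    split; first exact: longest_conj.
    by move=> /= E; apply: ase; rewrite /= -[a]MK E MK.
  split; first exact: longest_conj.
  by move=> /= E; apply: rt; rewrite /= -E MK.
have maxE : coset_max S (dcoset (M `\ s) I' (longest S M)) = longest S M.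
  rewrite (dcoset_core IE); apply: coset_max_descents.
    by move=> a [/MS].
  by move=> r [rM _]; apply: longest_descent.
split; last by rewrite maxE.
have I'M : I' `<=` M by move=> a [].
by split=> //; split=> //; split=> //; exact: fD.
Qed.

(** Phrased through [x] so that the induction can change [I] while [J] stays fixed. The empty list
    is separate because [expr_prod] gives it 1 rather than w_I. *)
Lemma core_atomic_expression I J x : finitary S I -> finitary S J ->
  I = [set x * s * x^-1 | s in J] ->
  (forall s, I s -> (ell x < ell (s * x))%N) ->
  exists e, [/\ expression S I J e, atomic_pieces S I e &
    match e with
    | [::] => x = 1
    | _ => longest S I * x = expr_prod S e /\
           (ell (longest S I * x))%:Z%R = expr_len S e
    end].
Proof.
move: {2}(ell x) (leqnn (ell x)) => n.
elim: n I x => [|n IHn] I x xn If Jf IE xI.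
  have x1 : x = 1 by apply: len_eq0; lia.
  exists [::]; split=> //; split=> //; rewrite IE x1.
  by under eq_imagel do rewrite mul1g invg1 mulg1; rewrite image_id.
have [x1|xN1] := pselect (x = 1); first by apply: IHn => //; rewrite x1 len1.
have [IS Ifin] := If; have [JS _] := Jf.
(* [S] itself is taken as a parabolic type, so that [parabolic_descent] applies to [x]. *)
have SS : S `<=` S by [].
have xS : parabolic S x.
  apply/parabolic_word => //.
  by have [u [uS ux _]] := reduced_word x; exists u.
have [s [sS sx]] := parabolic_descent SS xS xN1.
have sNI : ~ I s by move=> /xI; lia.
have [wI wmax] := longestP If.
pose y := longest S I * x; pose M := s |` I.
have ylen : ell y = (ell (longest S I) + ell x)%N.
  by apply: (len_parabolicM IS xI).
have ydesc r : M r -> (ell (r * y) < ell y)%N.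
  case=> [->|rI]; first exact: (core_longest_descent If JS IE xI sS sx).
  have rwI : parabolic I (r * longest S I).
    by apply: parabolicM => //; apply: sub_parabolic.
  rewrite ylen /y mulgA (len_parabolicM IS xI rwI) ltn_add2r.
  exact: longest_descent.
have MS : M `<=` S by move=> r [->|/IS].
have Mf : finitary S M.
  apply: (finitary_descents MS _ ydesc); rewrite finite_setU; split.
    exact: finite_set1.
  by apply: sub_finite_set Ifin => r; apply: sub_parabolic.
have [wM wMmax] := longestP Mf.
have IM : I `<=` M by move=> r; right.
have Ms : M s by left.
pose x' := longest S M * y.
have x'E : longest S M * x' = y by rewrite /x' -{1}(longestV Mf) mulKg.
have x'len : (ell x' + ell (longest S M))%N = ell y.
  by have := len_descents MS ydesc wM; rewrite longestV.
(* This strict inequality makes [x'] shorter than [x]. If [s] did not lengthen w_I, exchange in a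
   word in [I] would put [s] in W_I, hence in [I]. *)
have IltM : (ell (longest S I) < ell (longest S M))%N.
  have swM : parabolic M (s * longest S I).
    by apply: parabolicM; [exact: sub_parabolic|exact: parabolicS IM _ wI].
  have [E|E] := len_genMP (longest S I) sS.
    by have := wMmax _ swM; rewrite E.
  have [u [uI uw usz]] := reduced_parabolic_word IS wI.
  case: sNI; apply: (parabolic_gen IS sS).
  have : s \in refl_seq u.
    by apply: exchange => //; [exact: word_on_sub uI|rewrite uw E].
  case/refl_seq_split => [r /uI/IS|u1 [r [u2 [uE]]]].
    exact: gen_involution.
  rewrite uw => sw; rewrite -[s](mulgK (longest S I)) sw.
  apply: parabolicM; last exact: parabolicV.
  apply/parabolic_word => //; exists (u1 ++ u2) => //.
  move: uI; rewrite uE => /word_on_cat[u1I /word_on_cons[_ u2I]].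
  exact/word_on_cat.
pose I' := M `\ (longest S M * s * longest S M).
have I'M : I' `<=` M by move=> r [].
have I'f : finitary S I'.
  split; first exact: subset_trans MS.
  by case: Mf => _; apply: sub_finite_set; apply: parabolicS.
have I'E : I' = [set x' * r * x'^-1 | r in J] by apply: core_shift.
(* Here r x' = (w_M r)^-1 y, and w_M r is shorter than w_M, so less length is removed from [y]. *)
have x'I r : I' r -> (ell x' < ell (r * x'))%N.
  move=> /I'M rM; have rwM : parabolic M (longest S M * r).
    by apply: parabolicM => //; apply: sub_parabolic.
  have := len_descents MS ydesc rwM.
  rewrite invgM (gen_inv (MS _ rM)) longestV // -mulgA -/x' -x'len => E.
  have lt : (ell (longest S M * r) < ell (longest S M))%N.
    rewrite -lenV invgM (gen_inv (MS _ rM)) longestV //.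
    exact: longest_descent.
  by rewrite -(ltn_add2r (ell (longest S M * r))) E ltn_add2l.
have [|e [eE eA eP]] := IHn _ x' _ I'f Jf I'E x'I; first lia.
exists ((M, I') :: e); split.
- by split=> //; split=> //; apply: expression_finitary eE.
- split=> //; have -> : I = M `\ s by rewrite /M setUKD // => r [/= ->].
  exact: atomic_piece.
(* If nothing remains, y = w_M. Otherwise the tail contributes w_I' x', whose factor w_I' cancels
   against the inverse in the head. *)
case: e eP {eE eA} => [x'1|p e [eP eL]].
  by rewrite /= -/y -x'E x'1 mulg1.
have [wI' _] := longestP I'f.
have I'S : I' `<=` S by apply: subset_trans MS.
have lenI' := len_parabolicM I'S x'I wI'.
rewrite -/y; split.
  by rewrite [RHS]/= -/(expr_prod S (p :: e)) -eP mulgA mulgVK x'E.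
rewrite [RHS]/= -/(expr_len S (p :: e)) -eL lenI' -x'len; lia.
Qed.

End CoxeterGroup.

(** * From the coset to its minimal element *)

Theorem theorem1p8 (W : groupType) (S : set W) (hS : coxeter_system S)
    (I J : set W) (hI : finitary S I) (hJ : finitary S J)
    (p : set W) (hp : core_coset S I J p) :
  exists e : seq (set W * set W), reduced_atomic_expression S I J p e.
Proof.
have [[w pE] IE] := hp; have [IS _] := hI.
have [|xp xmin] := @coset_minP W S hS p.
  exists w; rewrite pE; exists 1, 1; rewrite mul1g mulg1.
  by split=> //; apply: parabolic1.
move: IE xp xmin; set x := coset_min S p => IE xp xmin.
(* The double coset is rewritten with its minimal element as representative. *)
have {}pE : p = dcoset I J x.
  move: xp; rewrite pE => -[a [b [aI bJ ->]]].
  apply/seteqP; split=> _ [c [d [cI dJ ->]]].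
    exists (c * a^-1), (b^-1 * d); split; last by rewrite !mulgA mulgVK mulgK.
      by apply: parabolicM => //; apply: parabolicV.
    by apply: parabolicM => //; apply: parabolicV.
  exists (c * a), (b * d); split; last by rewrite !mulgA.
    exact: parabolicM.
  exact: parabolicM.
have {}xmin s : I s -> (len S x < len S (s * x))%N.
  move=> sI; apply: xmin; first exact: IS.
  rewrite pE; exists s, 1; rewrite mulg1; split=> //.
    exact: sub_parabolic.
  exact: parabolic1.
have [e [eE eA eP]] := core_atomic_expression hS hI hJ IE xmin.
exists e; do !split=> //; rewrite pE (dcoset_core IE).
have [wI _] := longestP hI.
(* W_I x is also W_I (w_I x), and every element of [I] is a left descent of w_I x. *)
have maxE : coset_max S [set z | exists2 c, parabolic I c & z = c * x] =
    longest S I * x.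
  rewrite -[RHS](coset_max_descents hS IS); last first.
    move=> s sI; rewrite mulgA !(len_parabolicM hS IS xmin) ?ltn_add2r //.
      exact: longest_descent.
    by apply: parabolicM => //; apply: sub_parabolic.
  congr (coset_max S _); apply/seteqP; split=> _ [c cI ->].
    exists (c * (longest S I)^-1); last by rewrite !mulgA mulgVK.
    by apply: parabolicM => //; apply: parabolicV.
  exists (c * longest S I); last by rewrite mulgA.
  exact: parabolicM.
(* For the trivial expression x = 1, so the coset is W_I itself. *)
case: e eP {eE eA} => [x1|q e eP]; last by rewrite maxE.
apply/seteqP; split=> [_ [c cI ->]|c cI]; first by rewrite x1 mulg1.
by exists c; rewrite ?x1 ?mulg1.
Qed.
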